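(* For every odd integer $n\ge3$, $P_n(z)=(1+z)\,q_n(z^2)$, and both $1+z$ and $q_n(z^2)$ are irreducible in $\mathbb{Q}[z]$; that is, this is the factorization of $P_n(z)$ into irreducibles over $\mathbb{Q}$.
   Context: For $0\le k\le n$ let $\mathcal{B}(n,k)=\binom{n}{\lfloor (n-k)/2\rfloor}$ and $P_n(z)=\sum_{k=0}^n\mathcal{B}(n,k)z^{n-k}$. Let $q_n(z)=\sum_{k=0}^{\lfloor n/2\rfloor}\binom{n}{k}z^k$ (the truncated binomial polynomial). *)

(* Defs.v *)
From mathcomp Require Import all_boot all_order all_algebra.

Set Implicit Arguments.
Unset Strict Implicit.
Unset Printing Implicit Defensive.

Import GRing.Theory.
Local Open Scope ring_scope.

(* Used only for k <= n, where the truncated subtraction n - k is exact. *)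
Definition ballotCoef (n k : nat) : nat := 'C(n, (n - k)./2).

Definition ballotPoly (n : nat) : {poly rat} :=
  \sum_(0 <= k < n.+1) (ballotCoef n k)%:R *: 'X^(n - k).

Definition truncBinom (n : nat) : {poly rat} :=
  \sum_(0 <= k < (n./2).+1) ('C(n, k))%:R *: 'X^k.

(* Main.v *)
Require Import Defs.
From mathcomp Require Import all_boot all_order all_algebra.
From mathcomp Require Import zify ring.

Set Implicit Arguments.
Unset Strict Implicit.
Unset Printing Implicit Defensive.

(* Let n = 2m + 1 and q = q_n. For a prime p with m < p <= n and r = n - p, the
   polynomial q is (1 + X)^r modulo p, while p^2 divides neither its leading
   coefficient 'C(n, m) nor its value (-1)^m 'C(2m, m) at -1. As in Eisenstein's
   criterion, a factor of q over the integers then has degree 0, r, m - r or m.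
   By Erdos' estimate of 'C(n, m) there are three primes in [m + 2, n] as soon
   as m >= 10, and no degree other than 0 and m is compatible with all of
   them; hence q is irreducible. If q(X^2) were reducible, then comparing
   G(X) G(-X) with q(X^2) for a factor G would make 'C(n, m) a rational square,
   although a prime in [m + 2, n] divides it exactly once. *)

(** * Three primes between m + 2 and 2 m + 1 *)

Lemma prime_dvd_fact p n : prime p -> (p %| n`!) = (p <= n).
Proof.
move=> p_pr; apply/idP/idP => [|le_pn]; last first.
  by rewrite dvdn_fact // prime_gt0.
elim: n => [|n IHn]; first by rewrite dvdn1 => /eqP p1; rewrite p1 in p_pr.
rewrite factS Euclid_dvdM // => /orP[/dvdn_leq -> //|/IHn]; exact: leqW.
Qed.

(** Legendre's formula with a range independent of [n], so that sums for several factorials combine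
    term by term. *)
Lemma logn_fact_widen p n b : prime p -> n <= b ->
  logn p n`! = \sum_(1 <= k < b.+1) n %/ p ^ k.
Proof.
move=> p_pr le_nb; rewrite (logn_fact _ p_pr).
rewrite [RHS](@big_cat_nat _ _ _ n.+1) //=.
rewrite [X in _ = _ + X]big_nat_cond [X in _ = _ + X]big1 ?addn0 // => k.
case/andP=> /andP[lt_nk _] _; apply/divn_small/(leq_trans lt_nk)/ltnW.
exact/ltn_expl/prime_gt1.
Qed.

Lemma dvdn_prod_primes (s : seq nat) n :
  uniq s -> {in s, forall p, prime p && (p %| n)} -> \prod_(p <- s) p %| n.
Proof.
elim: s => [|p s IHs] /=; first by rewrite big_nil dvd1n.
move=> /andP[p_s s_uniq] s_n; rewrite big_cons.
have /andP[p_pr p_n] := s_n p (mem_head _ _).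
have {}s_n: {in s, forall q, prime q && (q %| n)}.
  by move=> q q_s; apply: s_n; rewrite inE q_s orbT.
rewrite Gauss_dvd ?p_n ?IHs // big_seq_cond.
elim/big_rec: _ => [|q y /andP[q_s _] p_y]; first exact: coprimen1.
have /andP[q_pr _] := s_n q q_s.
rewrite coprimeMr p_y prime_coprime // dvdn_prime2 // andbT.
by apply: contraNneq p_s => ->.
Qed.

(** Two absorption identities meet at 'C(2m + 2, m); their common factor m + 1 cancels. *)
Lemma bin_mid_rec m :
  m.+2 * 'C(m.+1.*2.+1, m.+1) = 2 * (m.*2 + 3) * 'C(m.*2.+1, m).
Proof.
have := mul_bin_diag m.+1.*2.+1 m; have := mul_bin_down m.+1.*2 m.
rewrite doubleS /= (_ : m.*2.+2 - m = m.+2); last lia.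
set A := 'C(m.*2.+2, m); set B := 'C(_, m); set C := 'C(_, _) => H1 H2.
apply/eqP; rewrite -(eqn_pmul2l (ltn0Sn m)); apply/eqP.
by nia.
Qed.

(** Consecutive terms have ratio 2(2m + 3)/(m + 2) < 4. The extra factor in [bin_mid_ge] turns it
    into 2(2m + 3)/(m + 1) > 4. *)
Lemma bin_mid_le m : 'C(m.*2.+1, m) <= 4 ^ m.
Proof.
elim: m => // m IHm; rewrite -(leq_pmul2l (ltn0Sn m.+1)) bin_mid_rec expnS.
by move: ('C(_, _)) (4 ^ m) IHm => C F; nia.
Qed.

Lemma bin_mid_ge m : 4 ^ m <= m.+1 * 'C(m.*2.+1, m).
Proof.
elim: m => // m IHm; rewrite bin_mid_rec expnS.
by move: ('C(_, _)) (4 ^ m) IHm => C F; nia.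
Qed.

Lemma prime_dvd_bin_mid m p : prime p -> m.+1 < p <= m.*2.+1 ->
  p %| 'C(m.*2.+1, m).
Proof.
move=> p_pr /andP[lt_mp le_p].
have le_m: m <= m.*2.+1 by lia.
have := prime_dvd_fact m.*2.+1 p_pr; rewrite le_p -(bin_fact le_m).
rewrite (_ : m.*2.+1 - m = m.+1); last lia.
rewrite 2?Euclid_dvdM // !prime_dvd_fact //.
by case/or3P=> //; lia.
Qed.

(** An even n > 2 adds no prime. For n = 2m + 1, induction handles the primes up to m + 1, and the
    product of the others divides 'C(n, m), which is at most 4^m. *)
Lemma primorial_le n : \prod_(0 <= p < n.+1 | prime p) p <= 4 ^ n.
Proof.
have [k] := ubnP n; elim: k n => // k IHk n /ltnSE le_nk.
have [n_small|n_gt2] := leqP n 2.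
  by case: n n_small {le_nk} => [|[|[|//]]] _; rewrite unlock.
have [n_odd|n_even] := boolP (odd n); last first.
  rewrite big_mkcond big_nat_recr //= -big_mkcond /= ifN; last first.
    by apply: contra n_even => /even_prime[]; lia.
  case: n n_gt2 n_even le_nk => // n n_gt2 n_even le_nk.
  by rewrite muln1 (leq_trans (IHk n _)) // leq_exp2l.
have [m def_n] : exists m, n = m.*2.+1 by exists n./2; lia.
rewrite def_n (@big_cat_nat _ _ _ m.+2) //=; last lia.
have ->: 4 ^ m.*2.+1 = 4 ^ m.+1 * 4 ^ m by rewrite -expnD; congr (_ ^ _); lia.
apply: leq_mul; first by apply: IHk; lia.
apply: leq_trans (bin_mid_le m); apply: dvdn_leq; first by rewrite bin_gt0; lia.
rewrite -big_filter; apply: dvdn_prod_primes => [|p].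
  by rewrite filter_uniq ?iota_uniq.
rewrite mem_filter mem_index_iota => /andP[p_pr p_m].
by rewrite p_pr prime_dvd_bin_mid.
Qed.

(** * Prime powers in the middle binomial coefficient *)

Section MidBinomial.

Variable m : nat.
Let N := m.*2.+1.
Let B := 'C(N, m).

Let B_fact : B * (m`! * m.+1`!) = N`!.
Proof. by rewrite -(@bin_fact N m) /B /N; [congr (_ * (_ * _`!)) |]; lia. Qed.

Let B_gt0 : 0 < B. Proof. by rewrite bin_gt0 /N; lia. Qed.

Let logn_B p : prime p ->
  logn p B + (logn p m`! + logn p m.+1`!) = logn p N`!.
Proof. by move=> p_pr; rewrite -B_fact !lognM ?muln_gt0 ?fact_gt0. Qed.

(** The exponent of p is the sum over k of floor(N/p^k) - floor(m/p^k) - floor((m + 1)/p^k). As N =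
    m + (m + 1), each term is at most 1, and it vanishes once p^k > N. *)
Lemma pfactor_bin_mid_le p : prime p -> p ^ logn p B <= N.
Proof.
move=> p_pr; have p_gt1 := prime_gt1 p_pr.
have N_gt0 : 0 < N by rewrite /N; lia.
have /andP[le_pTN lt_NT] := trunc_log_bounds p_gt1 N_gt0.
set T := trunc_log p N in le_pTN lt_NT.
apply: (leq_trans _ le_pTN); rewrite leq_exp2l //.
have := logn_B p_pr.
rewrite !(@logn_fact_widen p _ N) //; try by rewrite /N; lia.
rewrite -big_split /= => H.
suff: \sum_(1 <= k < N.+1) N %/ p ^ k <=
      T + \sum_(1 <= k < N.+1) (m %/ p ^ k + m.+1 %/ p ^ k) by lia.
have le_TN: T <= N by apply/ltnW/(leq_trans (ltn_expl T p_gt1)).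
have sumT: T = \sum_(1 <= k < N.+1) (k <= T).
  rewrite (@big_cat_nat _ _ _ T.+1) //=.
  rewrite [X in _ + X]big_nat_cond [X in _ + X]big1 ?addn0; last first.
    by move=> k; lia.
  rewrite (@eq_big_nat _ _ _ _ _ _ (fun=> 1)); last by move=> k; lia.
  by rewrite sum_nat_const_nat muln1; lia.
rewrite [X in X + _]sumT -big_split /= big_nat_cond.
rewrite [leqRHS]big_nat_cond; apply: leq_sum => k.
rewrite andbT => /andP[k_gt0 _]; have [le_kT|lt_Tk] := leqP k T; last first.
  by rewrite divn_small // (leq_trans lt_NT) // leq_exp2l.
have pk_gt0 : 0 < p ^ k by rewrite expn_gt0; lia.
rewrite add1n -ltnS -(ltn_pmul2r pk_gt0).
apply: leq_ltn_trans (leq_trunc_div _ _) _.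
have := ltn_ceil m pk_gt0; have := ltn_ceil m.+1 pk_gt0; rewrite /N; nia.
Qed.

Lemma logn_bin_mid_large p : prime p -> N < p ^ 2 -> logn p B <= 1.
Proof.
move=> p_pr ltNp; rewrite -ltnS -(ltn_exp2l _ _ (prime_gt1 p_pr)).
exact: leq_ltn_trans (pfactor_bin_mid_le p_pr) ltNp.
Qed.

Let logn_fact1 p n : prime p -> N < p ^ 2 -> n <= N -> logn p n`! = n %/ p.
Proof.
move=> p_pr ltNp le_nN; rewrite (logn_fact_widen p_pr le_nN) big_nat_recl //.
rewrite expn1 big_nat_cond big1 ?addn0 // => k /andP[/andP[k_gt0 _] _].
apply/divn_small/(leq_trans (leq_ltn_trans le_nN ltNp)).
by rewrite leq_exp2l //; apply: prime_gt1.
Qed.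

(** If p <= m, then p occurs at most twice in N! and at least once in each of m! and (m + 1)!. If p
    = m + 1, it occurs once in N! and once in (m + 1)!. *)
Lemma prime_ndvd_bin_mid p :
  prime p -> N < p ^ 2 -> N %/ 3 < p <= m.+1 -> logn p B = 0.
Proof.
move=> p_pr ltNp /andP[ltp lep]; have := logn_B p_pr.
have p_gt0 := prime_gt0 p_pr.
rewrite !(logn_fact1 p_pr ltNp) ?/N; try lia.
have {}ltp: N < 3 * p by rewrite mulnC -ltn_divLR.
have mp: 0 < m.+1 %/ p by rewrite divn_gt0.
have lt2: m.*2.+1 %/ p < 3 by rewrite ltn_divLR.
have [le_pm|lt_mp] := leqP p m.
  by have : 0 < m %/ p; [rewrite divn_gt0 | lia].
have: m.*2.+1 %/ p < 2 by rewrite ltn_divLR //; lia.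
by clear -mp; move: (_ %/ _) (m.+1 %/ p) mp (m %/ p) => a b; lia.
Qed.

(* Erdos: primes at most s contribute at most N each, primes in (s, N/3] occur
   once, primes in (N/3, m + 1] do not occur. *)
Lemma bin_mid_le_primes s :
  N < s.+1 ^ 2 ->
  B <= N ^ s * (4 ^ (N %/ 3) * N ^ count prime (iota m.+2 m)).
Proof.
move=> ltNs; set l := primes B.
have l_uniq : uniq l by apply: primes_uniq.
have l_prime p : p \in l -> prime p by rewrite mem_primes => /and3P[].
have l_le p : p \in l -> p <= N.
  rewrite mem_primes => /and3P[p_pr _ p_B]; rewrite -(prime_dvd_fact _ p_pr).
  by rewrite -B_fact dvdn_mulr.
have prod_const (P : pred nat) : \prod_(p <- l | P p) N = N ^ count P l.
  by rewrite big_const_seq iter_muln muln1.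
have ->: B = \prod_(p <- l) p ^ logn p B.
  by rewrite {1}(prod_prime_decomp B_gt0) prime_decompE big_map.
rewrite (bigID (fun p => p <= s)) /=; apply: leq_mul.
  apply: (@leq_trans (\prod_(p <- l | p <= s) N)).
    rewrite big_seq_cond [leqRHS]big_seq_cond; apply: leq_prod => p.
    by case/andP=> /l_prime /pfactor_bin_mid_le.
  rewrite prod_const leq_pexp2l // -size_filter -[leqRHS](size_iota 1).
  apply: uniq_leq_size => [|p]; first exact: filter_uniq.
  rewrite mem_filter mem_iota => /andP[le_ps /l_prime/prime_gt0]; lia.
have large p : s < p -> N < p ^ 2.
  by move=> lt_sp; apply: leq_trans ltNs _; rewrite leq_exp2r.
rewrite (bigID (fun p => p <= N %/ 3)) /=; apply: leq_mul.
  apply: leq_trans (primorial_le _).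
  apply: (@leq_trans (\prod_(p <- l | ~~ (p <= s) && (p <= N %/ 3)) p)).
    rewrite big_seq_cond [leqRHS]big_seq_cond; apply: leq_prod => p.
    case/and3P=> /l_prime p_pr; rewrite -ltnNge => /large ltNp _.
    by rewrite -[leqRHS]expn1 leq_pexp2l ?prime_gt0 ?logn_bin_mid_large.
  rewrite -big_filter; apply: dvdn_leq.
    by apply: prodn_cond_gt0 => p /prime_gt0.
  apply: dvdn_prod_primes => [|p]; first exact: filter_uniq.
  rewrite mem_filter => /andP[/andP[_ le_p] /l_prime p_pr]; rewrite p_pr /=.
  by rewrite -big_filter (big_rem p) ?dvdn_mulr // mem_filter p_pr
             mem_index_iota.
apply: (@leq_trans (\prod_(p <- l | ~~ (p <= s) && ~~ (p <= N %/ 3)) N)).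
  rewrite big_seq_cond [leqRHS]big_seq_cond; apply: leq_prod => p.
  by case/andP=> /l_prime /pfactor_bin_mid_le.
rewrite prod_const leq_pexp2l // -!size_filter; apply: uniq_leq_size => [|p].
  exact: filter_uniq.
rewrite !mem_filter mem_iota -!ltnNge => /andP[/andP[lt_sp ltp] p_l].
have p_pr := l_prime p p_l; rewrite p_pr /=.
have := l_le p p_l; suff: ~~ (p <= m.+1) by rewrite /N; lia.
apply/negP=> le_pm; have := prime_ndvd_bin_mid p_pr (large p lt_sp).
rewrite ltp le_pm => /(_ isT); move: p_l.
by rewrite -logn_gt0 => /[swap] ->.
Qed.

End MidBinomial.

Lemma exp4_gt t : 7 <= t -> 3 * (2 * (t.+1 * (2 ^ t.+1 + 2))) + 3 <= 4 ^ t.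
Proof.
elim: t => // t IHt; rewrite leq_eqVlt => /orP[/eqP[<-] //|].
rewrite ltnS => t_ge; have := IHt t_ge.
rewrite expnS (expnS 4) (expnS 2 t.+1); have := expnS 2 t.
have: 0 < 2 ^ t by rewrite expn_gt0.
move: (2 ^ t) (2 ^ t.+1) (4 ^ t) => a b c; nia.
Qed.

(** With at most two such primes, 4^m <= (m + 1) 'C(N, m) <= N^(s + 3) 4^(N/3) with s < 2 sqrt(N),
    which is impossible for large N. *)
Lemma count_prime_large m : 2 ^ 13 <= m -> 2 < count prime (iota m.+2 m).
Proof.
move=> m_ge; rewrite ltnNge; apply/negP => count_le2.
set N := m.*2.+1.
have N_gt0 : 0 < N by rewrite /N; lia.
have /andP[le_tN lt_Nt] := @trunc_log_bounds 4 N isT N_gt0.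
set t := trunc_log 4 N in le_tN lt_Nt.
(* The threshold 2^13 gives N > 2^14 = 4^7. *)
have t_ge : 7 <= t.
  apply: trunc_log_max; rewrite // -[4]/(2 ^ 2) -expnM (expnS 2 13).
  by rewrite /N; move: (2 ^ 13) m_ge => a; lia.
have := exp4_gt t_ge; set s := (2 ^ t.+1).-1.
have def_s : 2 ^ t.+1 = s.+1 by rewrite /s prednK // expn_gt0.
rewrite def_s => s_le.
have ltNs : N < s.+1 ^ 2 by rewrite -def_s -expnM mulnC expnM.
(* The exponent s + 3 collects s from the small primes, 2 from the large ones and 1 from m + 1 <=
   N. *)
have le1 : m.+1 * 'C(m.*2.+1, m) <= N ^ s.+3 * 4 ^ (N %/ 3).
  apply: (@leq_trans (N * (N ^ s * (4 ^ (N %/ 3) * N ^ 2)))).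
    apply: leq_mul; first by rewrite /N; lia.
    apply: leq_trans (bin_mid_le_primes ltNs) _.
    by rewrite !leq_mul2l leq_pexp2l // !orbT.
  by rewrite !expnS expn0 muln1; move: (N ^ s) (4 ^ _) => *; lia.
have := leq_trans (bin_mid_ge m) le1; apply/negP; rewrite -ltnNge.
have lt2 : N ^ s.+3 < 4 ^ (t.+1 * s.+3) by rewrite expnM ltn_exp2r.
apply: (@leq_trans (4 ^ (t.+1 * s.+3) * 4 ^ (N %/ 3))).
  by rewrite ltn_pmul2r // expn_gt0.
rewrite -expnD leq_exp2l //.
have : 3 * (N %/ 3) <= N by rewrite mulnC leq_trunc_div.
have {s_le} := leq_trans s_le le_tN; rewrite addn2 /N.
by move: (t.+1 * _) (_ %/ _) => x y; lia.
Qed.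

Lemma three_primes m : 10 <= m ->
  exists p q r, [/\ prime p, prime q, prime r, m.+1 < p < q & q < r <= m.*2.+1].
Proof.
move=> m_ge; have [m_large|m_small] := leqP (2 ^ 13) m.
  have := count_prime_large m_large; rewrite -size_filter.
  have := filter_uniq prime (iota_uniq m.+2 m).
  have : sorted ltn [seq p <- iota m.+2 m | prime p].
    by apply: sorted_filter (iota_ltn_sorted _ _) => ? ? ?; apply: ltn_trans.
  have s_mem p : p \in [seq p <- iota m.+2 m | prime p] ->
    prime p /\ m.+1 < p <= m.*2.+1.
    by rewrite mem_filter mem_iota => /andP[-> ?]; split=> //; lia.
  case: [seq p <- _ | _] s_mem => [|p [|q [|r s]]] //= s_mem.
  case/and3P=> lt_pq lt_qr _ _ _; exists p, q, r.
  have [|p_pr p_m] := s_mem p; first by rewrite !inE eqxx.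
  have [|q_pr _] := s_mem q; first by rewrite !inE eqxx orbT.
  have [|r_pr r_m] := s_mem r; first by rewrite !inE eqxx !orbT.
  by split=> //; lia.
pose concl := exists p q r,
  [/\ prime p, prime q, prime r, m.+1 < p < q & q < r <= m.*2.+1].
(* A triple settles every m with r <= 2m + 1 and m + 1 < p. Below, each r is at most 2p - 1 for the
   preceding p, so no m is skipped, and the last p exceeds 2^13 + 1. *)
have step p q r : [&& prime p, prime q, prime r, p < q & q < r] ->
    r <= m.*2.+1 -> (p <= m.+1 -> concl) -> concl.
  case/and5P=> p_pr q_pr r_pr lt_pq lt_qr le_r le_p.
  have [/le_p //|lt_mp] := leqP p m.+1; exists p, q, r; split=> //; lia.
(* Literals above 5000 are opaque to lia, hence the sums below. *)
apply: (step 13 17 19) => [||le1]; [by vm_compute | lia |].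
apply: (step 17 19 23) => [||le2]; [by vm_compute | lia |].
apply: (step 23 29 31) => [||le3]; [by vm_compute | lia |].
apply: (step 37 41 43) => [||le4]; [by vm_compute | lia |].
apply: (step 67 71 73) => [||le5]; [by vm_compute | lia |].
apply: (step 113 127 131) => [||le6]; [by vm_compute | lia |].
apply: (step 199 211 223) => [||le7]; [by vm_compute | lia |].
apply: (step 383 389 397) => [||le8]; [by vm_compute | lia |].
apply: (step 751 757 761) => [||le9]; [by vm_compute | lia |].
apply: (step 1489 1493 1499) => [||le10]; [by vm_compute | lia |].
apply: (step 2963 2969 2971) => [||le11]; [by vm_compute | lia |].
apply: (step (5000 + 897) (5000 + 903) (5000 + 923)) => [||le12];
  [by vm_compute | lia |].
apply: (step (11 * 1000 + 779) (11 * 1000 + 783) (11 * 1000 + 789)) =>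
  [||le13]; [by vm_compute | lia |].
lia.
Qed.

(** * Irreducibility criteria *)

Import GRing.Theory Num.Theory.
Local Open Scope ring_scope.

Lemma size_comp_X2 (F : fieldType) (p : {poly F}) :
  p != 0 -> size (p \Po 'X^2) = (size p).*2.-1.
Proof.
have := size_comp_poly p 'X^2; rewrite size_polyXn /= => size_p p_neq0.
have X2_size : (1 < size ('X^2 : {poly F}))%N by rewrite size_polyXn.
have : (0 < size p)%N by rewrite size_poly_gt0.
have : (0 < size (p \Po 'X^2))%N by rewrite size_poly_gt0 comp_poly_eq0.
by move: size_p; move: (size _) (size _) => a b; lia.
Qed.

(** For the converse, divide q by p: the remainder composed with X^2 would be a multiple of p(X^2)
    of smaller degree, hence it is zero. *)
Lemma dvdp_comp_X2 (F : fieldType) (p q : {poly F}) :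
  (p \Po 'X^2 %| q \Po 'X^2) = (p %| q).
Proof.
apply/idP/idP => [|/dvdp_comp_poly->//].
have X2_size : (1 < size ('X^2 : {poly F}))%N by rewrite size_polyXn.
rewrite {1}(divp_eq q p) comp_polyD comp_polyM dvdp_addr ?dvdp_mull //.
have [->|p_neq0] := eqVneq p 0.
  by rewrite modp0 comp_poly0 !dvd0p comp_poly_eq0.
have [mod0 _|r_neq0] := eqVneq (q %% p) 0; first by apply/modp_eq0P.
move/dvdp_leq; rewrite comp_poly_eq0 // => /(_ r_neq0).
rewrite !size_comp_X2 // => le_pr.
have le_double a b : (0 < b -> a.*2.-1 <= b.*2.-1 -> a <= b)%N by lia.
have : (size p <= size (q %% p)%R)%N.
  by apply: le_double le_pr; rewrite size_poly_gt0.
by rewrite leqNgt ltn_modpN0.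
Qed.

(* If G divides q(X^2) then G(X)G(-X) = h(X^2) with h dividing q^2, so h is
   associated to 1, q or q^2; the hypothesis, obtained by comparing leading
   and constant coefficients, excludes the middle case. *)
Lemma irreducible_comp_X2 (F : fieldType) (q : {poly F}) :
    irreducible_poly q ->
    (forall x y, lead_coef q * y ^+ 2 =
                 (-1) ^+ (size q).-1 * q.[0] * x ^+ 2 -> x = 0) ->
  irreducible_poly (q \Po 'X^2).
Proof.
move=> q_irr q_nosq; have [q_size q_dvd] := q_irr.
have q_neq0 := irredp_neq0 q_irr.
have X2_size : (1 < size ('X^2 : {poly F}))%N by rewrite size_polyXn.
have f_neq0 : q \Po 'X^2 != 0 by rewrite comp_poly_eq0.
split=> [|G G_size G_dvd].
  by rewrite size_comp_X2 //; case: (size q) q_size => [|[]].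
have G_neq0 : G != 0.
  by apply: contraNneq f_neq0 => G0; rewrite G0 dvd0p in G_dvd.
(* With G = E(X^2) + X O(X^2), this gives G(X) G(-X) = h(X^2). *)
pose h := even_poly G ^+ 2 - 'X * odd_poly G ^+ 2.
have X2N : 'X^2 \Po - 'X = 'X^2 :> {poly F}.
  by rewrite comp_Xn_poly sqrrN.
have XN_size : size (- 'X : {poly F}) = 2%N by rewrite size_polyN size_polyX.
have GN_neq0 : G \Po - 'X != 0 by rewrite comp_poly_eq0 ?XN_size.
have h_comp : h \Po 'X^2 = G * (G \Po - 'X).
  have GE := poly_even_odd G.
  have GNE : G \Po - 'X =
      (even_poly G \Po 'X^2) - (odd_poly G \Po 'X^2) * 'X.
    rewrite -{1}GE comp_polyD comp_polyM -!comp_polyA X2N comp_polyX.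
    by rewrite mulrN.
  transitivity ((even_poly G \Po 'X^2 + (odd_poly G \Po 'X^2) * 'X) *
                (even_poly G \Po 'X^2 - (odd_poly G \Po 'X^2) * 'X)).
    rewrite /h comp_polyB (comp_polyM 'X) comp_polyX !rmorphXn /=; ring.
  by rewrite GE GNE.
have GN_dvd : G \Po - 'X %| q \Po 'X^2.
  by have := dvdp_comp_poly (- 'X) G_dvd; rewrite -comp_polyA X2N.
have h_dvd : h %| q * q.
  by rewrite -dvdp_comp_X2 h_comp comp_polyM dvdp_mul.
have h_neq0 : h != 0.
  by rewrite -(comp_poly_eq0 _ X2_size) h_comp mulf_neq0.
have h_size : size h = size G.
  have eq_double a b : (0 < a -> (b + b).-1 = a.*2.-1 -> a = b)%N by lia.
  have := size_comp_X2 h_neq0; rewrite h_comp size_mul // size_comp_poly2 //.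
  by apply: eq_double; rewrite size_poly_gt0.
(* Were q and h coprime, h would divide 1, although deg h = deg G > 0. *)
have q_dvd_h : q %| h.
  rewrite -[_ %| _]negbK -(irreducible_poly_coprime _ q_irr).
  apply/negP=> co_qh.
  case/eqP: G_size; rewrite -h_size; apply/eqP.
  rewrite -dvdp1 -(@Gauss_dvdpr _ _ q) ?mulr1; last first.
    by rewrite coprimep_sym.
  by rewrite -(@Gauss_dvdpr _ _ q) // coprimep_sym.
have [h1 def_h] := dvdpP _ _ q_dvd_h.
have h1_dvd : h1 %| q by move: h_dvd; rewrite def_h dvdp_mul2r.
have h1_neq0 : h1 != 0.
  by apply: contraNneq h_neq0 => h10; rewrite def_h h10 mul0r.
have [h1_size|h1_size] := eqVneq (size h1) 1%N; last first.
  rewrite -dvdp_size_eqp // -h_size def_h size_mul //.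
  rewrite (eqp_size (q_dvd h1 h1_size h1_dvd)).
  by rewrite size_comp_X2 // addnn.
have [c c_neq0 def_h1] : exists2 c, c != 0 & h1 = c%:P.
  by move/eqP: h1_size => /size_poly1P.
case/eqP: G_neq0; apply/eqP; rewrite -lead_coef_eq0; apply/eqP.
(* From h = c q: c q(0) = G(0)^2, and c times the leading coefficient of q is, up to the sign
   (-1)^(deg q), the square of that of G. *)
apply: (q_nosq _ G.[0]).
have def_h0 : h.[0] = G.[0] ^+ 2.
  have : (h \Po 'X^2).[0] = G.[0] ^+ 2.
    by rewrite h_comp hornerM horner_comp hornerN hornerX oppr0.
  by rewrite horner_comp hornerXn expr0n.
have lead_h : lead_coef h = (-1) ^+ (size q).-1 * lead_coef G ^+ 2.
  have : lead_coef (h \Po 'X^2) = lead_coef h.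
    by rewrite lead_coef_comp // lead_coefXn expr1n mulr1.
  have q_h : size q = size h by rewrite def_h def_h1 mul_polyC size_scale.
  rewrite h_comp lead_coefM lead_coef_comp ?XN_size // lead_coefN lead_coefX.
  by rewrite q_h -h_size => <-; ring.
apply: (mulfI c_neq0).
have ->: c * ((-1) ^+ (size q).-1 * q.[0] * lead_coef G ^+ 2) =
         (c * q.[0]) * ((-1) ^+ (size q).-1 * lead_coef G ^+ 2) by ring.
have ->: c * q.[0] = G.[0] ^+ 2 by rewrite -def_h0 def_h def_h1 hornerM hornerC.
rewrite -lead_h def_h def_h1 lead_coefM lead_coefC; ring.
Qed.

(* Modulo p, G and H are associated to (X - c)^s and (X - c)^t with s + t = r.
   If s and t were both positive, p would divide G(c) and H(c); if, say, t = 0,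
   then p cannot divide both leading coefficients, so H is constant or G keeps
   its degree s = r modulo p. *)
Lemma size_factor_mod_p (p r : nat) (c : int) (G H : {poly int}) :
    prime p ->
    map_poly intr (G * H) = ('X - c%:~R%:P) ^+ r :> {poly 'F_p} ->
    ~~ (p ^ 2 %| `|(G * H).[c]|)%N -> ~~ (p ^ 2 %| `|lead_coef (G * H)|)%N ->
  [\/ size G = 1%N, size H = 1%N, size G = r.+1 | size H = r.+1].
Proof.
move=> p_pr GH_mod c_p lead_p.
have intr_eq0 (z : int) : (z%:~R == 0 :> 'F_p) = (p %| `|z|)%N.
  by rewrite -(dvdz_pcharf (pchar_Fp p_pr)).
wlog H_size : G H GH_mod c_p lead_p /
    size (map_poly intr H : {poly 'F_p}) = 1%N.
  move=> IH; pose pi := map_poly (intr : int -> 'F_p).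
  have pw (K L : {poly int}) : K * L = G * H ->
      size (pi K) = 1%N \/ (p %| `|K.[c]|)%N.
    move=> KL; have : pi K %| ('X - c%:~R%:P) ^+ r.
      by rewrite -GH_mod -KL rmorphM dvdp_mulIl.
    case/dvdp_exp_XsubCP=> [[|k] _ K_eqp].
      by left; rewrite (eqp_size K_eqp) size_poly1.
    right; rewrite -intr_eq0 -horner_map -/pi.
    rewrite -rootE (eqp_root K_eqp) rootE horner_exp hornerXsubC subrr.
    by rewrite expr0n.
  have [HG|H_p] := pw H G (mulrC _ _); first exact: IH.
  have [GG|G_p] := pw G H erefl.
    have := IH H G; rewrite mulrC => /(_ GH_mod c_p lead_p GG).
    by case; [apply: Or42 | apply: Or41 | apply: Or44 | apply: Or43].
  by case/negP: c_p; rewrite hornerM abszM dvdn_mul.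
have [H_p|H_np] := boolP (p %| `|lead_coef H|)%N; last first.
  by apply: Or42; rewrite -H_size size_map_poly_id0 // intr_eq0.
have G_np : ~~ (p %| `|lead_coef G|)%N.
  by apply: contra lead_p => G_p; rewrite lead_coefM abszM dvdn_mul.
apply: Or43; rewrite -(@size_map_poly_id0 _ 'F_p intr G) ?intr_eq0 //.
have := size_exp_XsubC r (c%:~R : 'F_p); rewrite -GH_mod rmorphM /=.
move/eqP: H_size => /size_poly1P[a a_neq0 ->].
by rewrite mulrC mul_polyC size_scale.
Qed.

(** * The truncated binomial polynomial *)

(** The ring is a parameter so that the same polynomial is available over the integers, the
    rationals and ['F_p]. *)
Definition midPoly (R : nzRingType) (m : nat) : {poly R} :=
  \poly_(k < m.+1) 'C(m.*2.+1, k)%:R.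

Lemma size_midPoly (m : nat) : size (midPoly int m) = m.+1.
Proof.
by rewrite size_poly_eq // pnatr_eq0 -lt0n bin_gt0; lia.
Qed.

Lemma midPoly_map (R S : nzRingType) (f : {rmorphism R -> S}) (m : nat) :
  map_poly f (midPoly R m) = midPoly S m.
Proof.
apply/polyP=> i; rewrite coef_map !coef_poly.
by case: ifP => _; [apply: rmorph_nat | apply: rmorph0].
Qed.

(** Write n = p + r. In Vandermonde's sum for 'C(p + r, k) with k <= m < p, p divides every term
    except 'C(r, k). Since r <= m, the truncation loses nothing of (1 + X)^r. *)
Lemma midPoly_mod_p (p m : nat) : prime p -> (m < p <= m.*2.+1)%N ->
  midPoly 'F_p m = ('X - (-1)%:P) ^+ (m.*2.+1 - p).
Proof.
move=> p_pr /andP[lt_mp le_p]; set r := (m.*2.+1 - p)%N.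
have -> : 'X - (-1)%:P = 1 + 'X :> {poly 'F_p} by rewrite rmorphN opprK addrC.
apply/polyP=> k; rewrite exprDn coef_sum coef_poly.
transitivity ('C(r, k)%:R : 'F_p); last first.
  have [lt_kr|le_rk] := ltnP k r.+1.
    rewrite (bigD1 (Ordinal lt_kr)) //= big1 ?addr0 => [|i].
      by rewrite expr1n mul1r coefMn coefXn eqxx.
    rewrite expr1n mul1r coefMn coefXn eq_sym -val_eqE /=.
    by move/negPf->; rewrite mul0rn.
  rewrite bin_small // big1 // => i _.
  rewrite expr1n mul1r coefMn coefXn (_ : (k == i) = false) ?mul0rn //.
  by have := ltn_ord i; lia.
have [lt_km|lt_mk] := ltnP k m.+1; last by rewrite bin_small //; lia.
rewrite (_ : m.*2.+1 = p + r)%N; last by rewrite /r; lia.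
rewrite -binomial.Vandermonde natr_sum big_ord_recl bin0 mul1n subn0.
rewrite big1 ?addr0 // => i _; apply/eqP.
rewrite -(dvdn_pcharf (pchar_Fp p_pr)).
by rewrite dvdn_mulr // prime_dvd_bin //= /bump; have := ltn_ord i; lia.
Qed.

Lemma sum_sign_bin (n k : nat) :
  \sum_(i < k.+1) (-1) ^+ i * 'C(n.+1, i)%:R = (-1) ^+ k * 'C(n, k)%:R :> int.
Proof.
elim: k => [|k IHk]; first by rewrite big_ord1 !bin0.
by rewrite big_ord_recr /= IHk binS natrD exprS; ring.
Qed.

Lemma midPolyN1 (m : nat) : (midPoly int m).[-1] = (-1) ^+ m * 'C(m.*2, m)%:R.
Proof.
rewrite horner_poly -sum_sign_bin; apply: eq_bigr => i _; exact: mulrC.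
Qed.

Lemma lead_coef_midPoly (m : nat) :
  lead_coef (midPoly int m) = 'C(m.*2.+1, m)%:R.
Proof. by rewrite lead_coef_poly //= pnatr_eq0 -lt0n bin_gt0; lia. Qed.

(** Among 1, ..., n only p itself can be a multiple of p. *)
Lemma prime_sqr_ndvd_fact p n : prime p -> (n < p.*2)%N -> ~~ (p ^ 2 %| n`!)%N.
Proof.
move=> p_pr; rewrite pfactor_dvdn ?fact_gt0 // -ltnNge ltnS => n_lt.
suff logn_le : (logn p n`! <= (p <= n))%N.
  by apply: leq_trans logn_le (leq_b1 _).
elim: n n_lt => [|n IHn] n_lt; first by rewrite logn1.
rewrite factS lognM ?fact_gt0 //; have {IHn} := IHn (ltnW n_lt).
have p_gt1 := prime_gt1 p_pr.
have [lt_np|lt_pn|eq_np] := ltngtP n.+1 p.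
- by rewrite (lognE p n.+1) p_pr gtnNdvd //=; lia.
- rewrite (lognE p n.+1) p_pr (_ : (p %| n.+1)%N = false) /=; first lia.
  by apply/negP => /dvdnP[k]; case: k => [|[|k]]; lia.
by rewrite eq_np (logn_prime p p_pr) eqxx; lia.
Qed.

Lemma prime_sqr_ndvd_bin p n k :
  prime p -> (k <= n < p.*2)%N -> ~~ (p ^ 2 %| 'C(n, k))%N.
Proof.
move=> p_pr /andP[le_kn lt_n]; apply: contra (prime_sqr_ndvd_fact p_pr lt_n).
by rewrite -(bin_fact le_kn); apply: dvdn_mulr.
Qed.

(** If d is neither 0 nor m, every such p has 2m + 1 - p equal to d or m - d, which at most two
    primes can satisfy. *)
Lemma degree_sieve m d : (0 < m)%N ->
    (forall p, prime p -> (m < p <= m.*2.+1)%N ->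
      [\/ d = 0, d = m, d = m.*2.+1 - p | d = p - m.+1]%N) ->
  d = 0%N \/ d = m.
Proof.
move=> m_gt0 sieve; have [m_ge10|m_lt10] := leqP 10 m.
  have [p [q [r [p_pr q_pr r_pr]]]] := three_primes m_ge10.
  have := sieve p p_pr; have := sieve q q_pr; have := sieve r r_pr.
  by move=> Hr Hq Hp le_pq le_qr; case: Hp; case: Hq; case: Hr; lia.
have prime_sieve p : prime p -> p = m.*2.+1 \/ p = m.+1 -> d = 0%N \/ d = m.
  by move=> p_pr def_p; have := sieve p p_pr; case=> //; lia.
have := sieve 11 isT; have := sieve 13 isT.
(* For m = 7 neither 15 nor 8 is prime, but 13 and 11 allow the disjoint sets {2, 5} and {4, 3}. For
   every other m < 10, 2m + 1 or m + 1 is prime and alone suffices. *)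
case: (m =P 7) => [->|m_neq7].
  by move=> H1 H2; case: H1; case: H2; lia.
move=> _ _; have [p_pr|] := boolP (prime m.*2.+1).
  by apply: prime_sieve p_pr _; left.
have [p_pr _|] := boolP (prime m.+1).
  by apply: prime_sieve p_pr _; right.
by move: m m_gt0 m_lt10 m_neq7 {sieve prime_sieve}; do 10?case=> //.
Qed.

(** By Gauss's lemma a rational factor is a multiple of an integer one, whose degree is restricted
    at each prime p in (m, 2m + 1]. As 2m + 1 < 2p, p^2 divides neither binomial coefficient
    involved. *)
Lemma irreducible_midPoly m : (0 < m)%N -> irreducible_poly (midPoly rat m).
Proof.
move=> m_gt0; rewrite -(midPoly_map (intr : int -> rat)).
split=> [|G G_size G_dvd]; first by rewrite size_rat_int_poly size_midPoly.
have [G1 [a a_neq0 def_G] [H def_GH]] := dvdpP_rat_int G_dvd.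
have G1_size : size G = size G1.
  by rewrite def_G size_scale // size_rat_int_poly.
have : G1 * H != 0 by rewrite -def_GH -size_poly_gt0 size_midPoly.
rewrite mulf_eq0 negb_or => /andP[G1_neq0 H_neq0].
have size_GH : (size G1 + size H)%N = m.+2.
  have eq_pred k : (k.-1 = m.+1 -> k = m.+2)%N by lia.
  by apply: eq_pred; rewrite -size_mul // -def_GH size_midPoly.
have G1_gt0 : (0 < size G1)%N by rewrite size_poly_gt0.
rewrite -dvdp_size_eqp // G1_size size_rat_int_poly size_midPoly.
suff [] : (size G1).-1 = 0%N \/ (size G1).-1 = m.
- by move: G_size; rewrite G1_size; lia.
- by move: G1_gt0; lia.
apply: degree_sieve m_gt0 _ => p p_pr p_m.
have [] := @size_factor_mod_p p (m.*2.+1 - p) (-1) G1 H p_pr.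
- by rewrite -def_GH midPoly_map midPoly_mod_p // rmorphN1.
- rewrite -def_GH midPolyN1 abszM abszX natz !absz_nat exp1n mul1n.
  by apply: prime_sqr_ndvd_bin; lia.
- by rewrite -def_GH lead_coef_midPoly natz absz_nat prime_sqr_ndvd_bin //; lia.
- by move=> ->; apply: Or41.
- by move=> H_size; apply: Or42; lia.
- by move=> ->; apply: Or43.
by move=> H_size; apply: Or44; lia.
Qed.

Lemma prime_in_upper_half m : (0 < m)%N ->
  exists2 p, prime p & (m.+1 < p <= m.*2.+1)%N.
Proof.
move=> m_gt0; have [m_ge10|m_lt10] := leqP 10 m.
  have [p [q [r [p_pr _ _ /andP[lt_mp lt_pq] /andP[lt_qr le_r]]]]] :=
    three_primes m_ge10.
  by exists p => //; lia.
have [m_ge5|m_lt5] := leqP 5 m; first by exists 11 => //; lia.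
have [m_ge3|m_lt3] := leqP 3 m; first by exists 7 => //; lia.
have [m_ge2|m_lt2] := leqP 2 m; first by exists 5 => //; lia.
by exists 3 => //; lia.
Qed.

Lemma bin_mid_nsquare m (z : rat) : (0 < m)%N -> z ^+ 2 != 'C(m.*2.+1, m)%:R.
Proof.
move=> m_gt0; have [p p_pr p_m] := prime_in_upper_half m_gt0.
set B := 'C(_, m); have B_gt0 : (0 < B)%N by rewrite bin_gt0; lia.
have logB : logn p B = 1%N.
  apply/eqP; rewrite eqn_leq; apply/andP; split; last first.
    by rewrite logn_gt0 mem_primes p_pr B_gt0 prime_dvd_bin_mid.
  rewrite leqNgt -(pfactor_dvdn _ p_pr B_gt0).
  by apply: prime_sqr_ndvd_bin => //; lia.
apply/eqP => zB.
have : numq z ^+ 2 = B%:R * denq z ^+ 2.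
  apply: (intr_inj : injective (intr : int -> rat)).
  rewrite [RHS]rmorphM !rmorphXn /=.
  by rewrite rmorph_nat -zB -exprMn -numqE.
move/(congr1 absz); rewrite abszM !abszX natz absz_nat.
have den_gt0 : (0 < `|denq z|)%N by rewrite absz_gt0 denq_neq0.
(* Valuations at p give an even number equal to an odd one. *)
move=> /(congr1 (logn p)); rewrite lognM ?expn_gt0 ?den_gt0 // !lognX logB.
by lia.
Qed.

(** The terms of degrees 2k and 2k + 1 share a coefficient, so each pair yields a factor 1 + X. *)
Lemma sum_pairs (R : comNzRingType) (F : nat -> R) j :
  \sum_(0 <= k < j.*2) F k./2 *: 'X^k =
  (1 + 'X) * \sum_(0 <= k < j) F k *: ('X^2) ^+ k.
Proof.
elim: j => [|j IHj]; first by rewrite !big_geq ?mulr0.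
rewrite doubleS !big_nat_recr //= IHj mulrDr uphalf_double doubleK.
by rewrite -!mul_polyC -exprM mul2n (exprS 'X j.*2); ring.
Qed.

Lemma truncBinom_midPoly m : truncBinom m.*2.+1 = midPoly rat m.
Proof. by rewrite /truncBinom /midPoly poly_def big_mkord /= uphalf_double. Qed.

Lemma ballotPoly_factor m :
  ballotPoly m.*2.+1 = (1 + 'X) * (truncBinom m.*2.+1 \Po 'X^2).
Proof.
set n := m.*2.+1.
have -> : truncBinom n \Po 'X^2 =
          \sum_(0 <= k < m.+1) ('C(n, k)%:R : rat) *: ('X^2) ^+ k.
  rewrite /truncBinom rmorph_sum /= uphalf_double; apply: eq_bigr => k _.
  by rewrite comp_polyZ comp_Xn_poly.
(* After reversal, X^j has coefficient 'C(n, floor(j/2)). *)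
rewrite -sum_pairs doubleS /ballotPoly big_nat_rev.
apply: eq_big_nat => k /andP[_ k_n].
by rewrite /ballotCoef add0n subSS subKn.
Qed.

Theorem theorem6p2 (n : nat) (n_odd : odd n) (n_ge3 : (3 <= n)%N) :
  [/\ ballotPoly n = (1 + 'X) * (truncBinom n \Po 'X^2),
      irreducible_poly (1 + 'X : {poly rat})
    & irreducible_poly (truncBinom n \Po 'X^2)].
Proof.
have [m def_n] : exists m, n = m.*2.+1 by exists n./2; lia.
have m_gt0 : (0 < m)%N by lia.
rewrite {n n_odd n_ge3}def_n; split; first exact: ballotPoly_factor.
  by rewrite addrC; apply: irredp_XaddC.
rewrite truncBinom_midPoly; apply: irreducible_comp_X2.
  exact: irreducible_midPoly.
have lead_mid : lead_coef (midPoly rat m) = 'C(m.*2.+1, m)%:R.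
  rewrite -(midPoly_map (intr : int -> rat)) lead_coef_map_inj //.
    by rewrite lead_coef_midPoly rmorph_nat.
  exact: intr_inj.
have mid0 : (midPoly rat m).[0] = 1 by rewrite horner_coef0 coef_poly bin0.
(* Absolute values remove the sign (-1)^m; a nonzero x would then make 'C(2m + 1, m) the square of
   |x|/|y|. *)
move=> x y; rewrite lead_mid mid0 mulr1 => /(congr1 Num.norm).
rewrite !normrM normrX normrN1 expr1n mul1r normr_nat -!expr2 => xy.
have [-> //|x_neq0] := eqVneq x 0.
have [y0|y_neq0] := eqVneq y 0.
  move/eqP: xy; rewrite y0 normr0 expr0n mulr0 eq_sym expf_eq0 normr_eq0.
  by rewrite (negPf x_neq0).
case/eqP: (bin_mid_nsquare (`|x| / `|y|) m_gt0).
by rewrite expr_div_n -xy mulfK // expf_neq0 // normr_eq0.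
Qed.
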